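(* Let $a=\tfrac13$ and $T>0$. Every critical curve $\gamma\in\mathcal{C}_T$ of the functional $\mathcal{B}_{1/3}(\gamma)=\int_0^T p(t)^{1/3}\,dt$ on $\mathcal{C}_T$ (that is, every relative extremum of $\mathcal{B}_{1/3}$ constrained by $\mathcal{A}$) is a multiply traversed conic.
   Context: $[\cdot,\cdot]$ denotes the determinant of two vectors in $\mathbb{R}^2$. $\mathcal{C}_T$ is the space of smooth $T$-periodic curves $\gamma:\mathbb{R}\to\mathbb{R}^2$ in centroaffine parameterization, i.e. $[\gamma,\gamma']=1$, with positive centroaffine curvature $p:=[\gamma',\gamma'']>0$; the centroaffine parameterization fixes the constraint $\mathcal{A}(\gamma)=\int_0^T[\gamma,\gamma']\,dt$. The infinitesimal deformations of $\gamma$ preserving $[\gamma,\gamma']=1$ are the vector fields $v_f=-\tfrac{f'}{2}\gamma+f\gamma'$ with $f$ a smooth $T$-periodic function. A curve $\gamma\in\mathcal{C}_T$ is critical for $\mathcal{B}_a(\gamma)=\int_0^Tp^a\,dt$ if $\frac{d}{d\varepsilon}\big|_{\varepsilon=0}\int_0^T[(\gamma+\varepsilon v_f)',(\gamma+\varepsilon v_f)'']^a\,dt=0$ for every smooth $T$-periodic $f$. ''Multiply traversed conic'' means an ellipse (not necessarily centered at the origin) traversed some number $m\ge1$ of times over the period. *)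

(* Defs.v *)
From Stdlib Require Export Reals.
From Coquelicot Require Export Coquelicot.
Open Scope R_scope.

(* The plane carries Coquelicot's product structure of R-module (plus, scal). *)
Definition plane : Type := (R * R)%type.

Definition det (x y : plane) : R := fst x * snd y - snd x * fst y.

Definition smooth (f : R -> R) : Prop := forall (n : nat) (t : R), ex_derive_n f n t.

Definition smooth_curve (g : R -> plane) : Prop :=
  smooth (fun t => fst (g t)) /\ smooth (fun t => snd (g t)).

Definition periodic {A : Type} (T : R) (g : R -> A) : Prop := forall t : R, g (t + T) = g t.

Definition velocity (g : R -> plane) (t : R) : plane :=
  (Derive (fun s => fst (g s)) t, Derive (fun s => snd (g s)) t).

Definition curvature (g : R -> plane) (t : R) : R :=
  det (velocity g t) (velocity (velocity g) t).

Record centroaffine_curve (T : R) (g : R -> plane) : Prop := {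
  ca_smooth : smooth_curve g;
  ca_periodic : periodic T g;
  ca_param : forall t : R, det (g t) (velocity g t) = 1;
  ca_curvature_pos : forall t : R, 0 < curvature g t
}.

(* Rpower is the real power only for a positive base. For g in C_T the curvature of
   a small deformation of g is positive by compactness of a period, so the
   conventional value for bases <= 0 does not affect the derivative at 0 below. *)
Definition curvature_functional (a T : R) (g : R -> plane) : R :=
  RInt (fun t => Rpower (curvature g t) a) 0 T.

Definition deformation_field (g : R -> plane) (f : R -> R) (t : R) : plane :=
  plus (scal (- (Derive f t / 2)) (g t)) (scal (f t) (velocity g t)).

Definition deform (g v : R -> plane) (eps t : R) : plane := plus (g t) (scal eps (v t)).

Definition critical_curve (a T : R) (g : R -> plane) : Prop :=
  forall f : R -> R, smooth f -> periodic T f ->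
    is_derive
      (fun eps => curvature_functional a T (deform g (deformation_field g f) eps)) 0 0.

(* The ellipse with centre c and conjugate semi-diameters u, w (linearly independent):
   the image of the unit circle under an arbitrary invertible affine map. *)
Definition ellipse_point (c u w : plane) (phi : R) : plane :=
  plus c (plus (scal (cos phi) u) (scal (sin phi) w)).

(* The angle theta runs monotonically, without backtracking, m times around the
   circle over one period; either orientation is allowed, by the sign of det u w. *)
Definition multiply_traversed_ellipse (T : R) (g : R -> plane) : Prop :=
  exists (c u w : plane) (theta : R -> R) (m : nat),
    det u w <> 0 /\
    (1 <= m)%nat /\
    (forall t : R, continuous theta t) /\
    (forall s t : R, s < t -> theta s < theta t) /\
    (forall t : R, theta (t + T) = theta t + 2 * PI * INR m) /\
    (forall t : R, g t = ellipse_point c u w (theta t)).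

(* Main.v *)
Require Import Defs.
From Stdlib Require Import ZArith Lra Lia FunctionalExtensionality.

(** Write [p] for the curvature, [h = p^(1/3)] and [G = p^(-2/3)], so that [gamma'' = - p gamma].
    The field [v_f] changes [p] to first order by [f'''/2 + 2 p f' + p' f]; integrating by
    parts over a period, the first variation of the functional is a multiple of the integral
    of [k' f], where [k = G''/2 - h]. Since [k'] is itself smooth and periodic it is an
    admissible [f], so [k' = 0].
    With respect to affine arclength [ds = h dt] this says [gamma_sss = k gamma_s] with [k]
    constant. As [G'] is periodic, [G'' = 2 (k + h)] cannot be positive throughout, hence
    [k < 0], and [gamma] is an affine image of uniform circular motion with angle
    [sqrt (-k) s]; periodicity of [gamma_s] makes the total angle a multiple of [2 PI]. *)

(** * Smooth functions and their closure properties *)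

Lemma smooth_ex_derive f t : smooth f -> ex_derive f t.
Proof. intros H; exact (H 1%nat t). Qed.

Lemma Derive_n_Derive f n t : Derive_n (Derive f) n t = Derive_n f (S n) t.
Proof.
  change (Derive f) with (Derive_n f 1).
  rewrite Derive_n_comp; f_equal; lia.
Qed.

Lemma smooth_Derive f : smooth f -> smooth (Derive f).
Proof.
  intros H [|n] t; [exact I|].
  apply (ex_derive_ext (Derive_n f (S n))).
  - intros s; symmetry; apply Derive_n_Derive.
  - exact (H (S (S n)) t).
Qed.

(** Peels derivatives off from the inside, whereas [Derive_n] adds them outside: the product and
    chain rules can then be applied once to the function itself, followed by induction on the
    order. *)
Fixpoint differentiable_upto (n : nat) (f : R -> R) : Prop :=
  match n with
  | O => True
  | S n => (forall t, ex_derive f t) /\ differentiable_upto n (Derive f)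
  end.

Lemma smooth_iff_upto f : smooth f <-> forall n, differentiable_upto n f.
Proof.
  split.
  - intros H n; revert f H; induction n as [|n IH]; intros f H; simpl; auto.
    split; [intros t; now apply smooth_ex_derive|].
    now apply IH, smooth_Derive.
  - intros H n; revert f H; induction n as [|n IH]; intros f H t; [exact I|].
    destruct n as [|n]; [exact (proj1 (H 1%nat) t)|].
    apply (ex_derive_ext (Derive_n (Derive f) n)).
    + intros s; apply Derive_n_Derive.
    + refine (IH (Derive f) _ t); intros m; exact (proj2 (H (S m))).
Qed.

(** Needed because the product and power rules keep the undifferentiated function next to its
    derivative, so both must be available at the same order. *)
Lemma differentiable_upto_pred n f : differentiable_upto (S n) f -> differentiable_upto n f.
Proof.
  revert f; induction n as [|n IH]; intros f [H1 H2]; simpl; auto.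
Qed.

Lemma differentiable_upto_const n c : differentiable_upto n (fun _ => c).
Proof.
  revert c; induction n as [|n IH]; intros c; simpl; auto.
  split; [intros t; apply ex_derive_const|].
  replace (Derive (fun _ : R => c)) with (fun _ : R => 0); [apply IH|].
  apply functional_extensionality; intros t; symmetry; apply Derive_const.
Qed.

Lemma differentiable_upto_plus n f g :
  differentiable_upto n f -> differentiable_upto n g ->
  differentiable_upto n (fun t => f t + g t).
Proof.
  revert f g; induction n as [|n IH]; intros f g; simpl; auto.
  intros [F1 F2] [G1 G2]; split.
  - intros t; now apply (ex_derive_plus f g).
  - replace (Derive (fun t => f t + g t)) with (fun t => Derive f t + Derive g t); [now apply IH|].
    apply functional_extensionality; intros t; symmetry; now apply Derive_plus.
Qed.

Lemma differentiable_upto_mult n f g :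
  differentiable_upto n f -> differentiable_upto n g ->
  differentiable_upto n (fun t => f t * g t).
Proof.
  revert f g; induction n as [|n IH]; intros f g; [simpl; auto|].
  intros F G.
  assert (F0 := differentiable_upto_pred _ _ F).
  assert (G0 := differentiable_upto_pred _ _ G).
  destruct F as [F1 F2], G as [G1 G2]; split.
  - intros t; now apply ex_derive_mult.
  - replace (Derive (fun t => f t * g t))
      with (fun t => Derive f t * g t + f t * Derive g t).
    + apply differentiable_upto_plus; now apply IH.
    + apply functional_extensionality; intros t; symmetry; now apply Derive_mult.
Qed.

Lemma is_derive_Rpower a x :
  0 < x -> is_derive (fun y => Rpower y a) x (a * Rpower x (a - 1)).
Proof. intros Hx; apply is_derive_Reals; now apply derivable_pt_lim_power. Qed.

Lemma is_derive_Rpower_comp a f t l :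
  0 < f t -> is_derive f t l ->
  is_derive (fun s => Rpower (f s) a) t (l * (a * Rpower (f t) (a - 1))).
Proof.
  intros Hpos Hf.
  apply (is_derive_comp (fun y => Rpower y a) f); trivial.
  now apply is_derive_Rpower.
Qed.

Lemma differentiable_upto_Rpower n a f :
  (forall t, 0 < f t) -> differentiable_upto n f ->
  differentiable_upto n (fun t => Rpower (f t) a).
Proof.
  (* The exponent stays general in the induction, since each differentiation lowers it by one. *)
  intros Hpos; revert a; induction n as [|n IH]; intros a F; [exact I|].
  assert (F0 := differentiable_upto_pred _ _ F); destruct F as [F1 F2].
  assert (D : forall t, is_derive (fun s => Rpower (f s) a) t
                (Derive f t * (a * Rpower (f t) (a - 1)))).
  { intros t; apply is_derive_Rpower_comp; trivial; now apply Derive_correct. }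
  split.
  - intros t; eexists; apply D.
  - replace (Derive (fun t => Rpower (f t) a))
      with (fun t => Derive f t * (a * Rpower (f t) (a - 1))).
    + apply differentiable_upto_mult; trivial.
      apply differentiable_upto_mult; [apply differentiable_upto_const|now apply IH].
    + apply functional_extensionality; intros t; symmetry; apply is_derive_unique, D.
Qed.

Lemma smooth_const c : smooth (fun _ => c).
Proof. apply smooth_iff_upto; intros n; apply differentiable_upto_const. Qed.

Lemma smooth_plus f g : smooth f -> smooth g -> smooth (fun t => f t + g t).
Proof.
  rewrite !smooth_iff_upto; intros F G n; now apply differentiable_upto_plus.
Qed.

Lemma smooth_mult f g : smooth f -> smooth g -> smooth (fun t => f t * g t).
Proof.
  rewrite !smooth_iff_upto; intros F G n; now apply differentiable_upto_mult.
Qed.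

Lemma smooth_Rpower a f :
  (forall t, 0 < f t) -> smooth f -> smooth (fun t => Rpower (f t) a).
Proof.
  rewrite !smooth_iff_upto; intros P F n; now apply differentiable_upto_Rpower.
Qed.

Lemma smooth_opp f : smooth f -> smooth (fun t => - f t).
Proof.
  intros F.
  replace (fun t => - f t) with (fun t => -1 * f t).
  - apply smooth_mult; trivial; apply smooth_const.
  - apply functional_extensionality; intros t; ring.
Qed.

Lemma smooth_minus f g : smooth f -> smooth g -> smooth (fun t => f t - g t).
Proof. intros F G; apply smooth_plus; trivial; now apply smooth_opp. Qed.

Lemma smooth_continuous f t : smooth f -> continuous f t.
Proof. intros F; now apply (ex_derive_continuous f), smooth_ex_derive. Qed.

Lemma smooth_is_derive f t : smooth f -> is_derive f t (Derive f t).
Proof. intros F; now apply Derive_correct, smooth_ex_derive. Qed.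

(* [auto_derive] eta-expands the functions it differentiates. *)
Ltac eta_Derive :=
  repeat match goal with
  | |- context [Derive (fun x => ?f x)] => progress change (Derive (fun x => f x)) with (Derive f)
  end.

Create HintDb smooth.
#[local] Hint Resolve smooth_const smooth_plus smooth_minus smooth_mult smooth_opp
  smooth_Derive : smooth.

(** * Periodicity and monotonicity *)

Lemma periodic_Derive T (f : R -> R) :
  (forall t, ex_derive f t) -> periodic T f -> periodic T (Derive f).
Proof.
  intros F P t.
  rewrite <- (Derive_ext (fun s => f (s + T)) f t P).
  symmetry; apply is_derive_unique.
  evar_last; [apply (is_derive_comp f (fun s => s + T))|].
  - now apply Derive_correct.
  - auto_derive; auto.
  - unfold scal; simpl; unfold mult; simpl; ring.
Qed.

Lemma constant_of_derive_zero (f : R -> R) :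
  (forall t, is_derive f t 0) -> forall s t, f s = f t.
Proof.
  intros H s t.
  destruct (MVT_gen f s t (fun _ => 0)) as [c [_ E]].
  - intros; apply H.
  - intros u _; apply continuity_pt_filterlim; apply (ex_derive_continuous f); eexists; apply H.
  - lra.
Qed.

Lemma nondecreasing_of_derive_nonneg (f df : R -> R) :
  (forall t, is_derive f t (df t)) -> (forall t, 0 <= df t) ->
  forall s t, s <= t -> f s <= f t.
Proof.
  intros H P s t L.
  destruct (MVT_gen f s t df) as [c [_ E]].
  - intros; apply H.
  - intros u _; apply continuity_pt_filterlim; apply (ex_derive_continuous f); eexists; apply H.
  - specialize (P c); nra.
Qed.

Lemma increasing_of_derive_pos (f df : R -> R) :
  (forall t, is_derive f t (df t)) -> (forall t, 0 < df t) ->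
  forall s t, s < t -> f s < f t.
Proof.
  intros H P s t L.
  destruct (MVT_gen f s t df) as [c [_ E]].
  - intros; apply H.
  - intros u _; apply continuity_pt_filterlim; apply (ex_derive_continuous f); eexists; apply H.
  - specialize (P c); nra.
Qed.

(** A monotone function that returns to its value after a period is squeezed to a constant. This
    replaces the statement that a nonnegative function with zero mean vanishes. *)
Lemma periodic_monotone_derive_zero T (f df : R -> R) :
  0 < T -> periodic T f -> (forall t, is_derive f t (df t)) -> (forall t, 0 <= df t) ->
  forall t, df t = 0.
Proof.
  intros HT P H N t.
  assert (M := nondecreasing_of_derive_nonneg f df H N).
  rewrite <- (is_derive_unique f t _ (H t)).
  apply is_derive_unique.
  apply (is_derive_ext_loc (fun _ => f t)); [|apply is_derive_Reals, derivable_pt_lim_const].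
  (* On the window of length [T] centred at [t] both ends carry the same value of [f], so [f] is
     constant there. *)
  assert (HT2 : 0 < T / 2) by lra.
  exists (mkposreal _ HT2); intros u Hu.
  change (Rabs (u - t) < T / 2) in Hu; apply Rabs_def2 in Hu.
  assert (A1 := M (t - T / 2) t ltac:(lra)).
  assert (A2 := M t (t - T / 2 + T) ltac:(lra)).
  assert (A3 := M (t - T / 2) u ltac:(lra)).
  assert (A4 := M u (t - T / 2 + T) ltac:(lra)).
  rewrite P in A2, A4; lra.
Qed.

(** * Primitives and differentiation under the integral sign *)

Lemma is_derive_primitive (f : R -> R) a t :
  (forall s, continuous f s) -> is_derive (fun t => RInt f a t) t (f t).
Proof.
  intros C; apply (is_derive_RInt f (fun t => RInt f a t) a).
  - exists (mkposreal 1 Rlt_0_1); intros u _.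
    apply (@RInt_correct R_CompleteNormedModule),
      (@ex_RInt_continuous R_CompleteNormedModule); auto.
  - apply C.
Qed.

(** The increment of the primitive over one period has derivative [f (t + T) - f t = 0], so it may
    be evaluated at 0. *)
Lemma primitive_shift T (f : R -> R) :
  (forall s, continuous f s) -> periodic T f ->
  forall t, RInt f 0 (t + T) = RInt f 0 t + RInt f 0 T.
Proof.
  intros C P t.
  assert (D : forall t, is_derive (fun t => RInt f 0 (t + T) - RInt f 0 t) t 0).
  { intros u; evar_last.
    - apply @is_derive_minus; [|now apply is_derive_primitive].
      apply (is_derive_comp (fun t => RInt f 0 t) (fun s => s + T)).
      + now apply is_derive_primitive.
      + auto_derive; auto.
    - unfold minus, plus, opp, scal; simpl; unfold mult; simpl; rewrite P; ring. }
  assert (E := constant_of_derive_zero _ D t 0); simpl in E.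
  rewrite RInt_point in E; rewrite Rplus_0_l in E; unfold zero in E; simpl in E; lra.
Qed.

(* Positivity of the base for small [e] is uniform over the compact interval, so the
   integrand stays in the range where [Rpower] is differentiable. *)
Lemma first_variation_RInt_Rpower (a T : R) (p q r : R -> R) :
  0 < T ->
  (forall t, continuous p t) -> (forall t, continuous q t) -> (forall t, continuous r t) ->
  (forall t, 0 < p t) ->
  is_derive (fun e => RInt (fun t => Rpower (p t + e * q t + e ^ 2 * r t) a) 0 T) 0
    (RInt (fun t => a * Rpower (p t) (a - 1) * q t) 0 T).
Proof.
  intros HT Cp Cq Cr Pp.
  set (P := fun e t => p t + e * q t + e ^ 2 * r t).
  assert (C2 : forall f, (forall t, continuous f t) ->
            forall e t, continuity_2d_pt (fun _ v => f v) e t).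
  { intros f Cf e t; apply (continuity_1d_2d_pt_comp f (fun _ v => v)).
    - apply continuity_pt_filterlim, Cf.
    - apply continuity_2d_pt_id2. }
  assert (CP : forall e t, continuity_2d_pt P e t).
  { intros e t; unfold P; apply continuity_2d_pt_plus; [apply continuity_2d_pt_plus|].
    - now apply C2.
    - apply continuity_2d_pt_mult; [apply continuity_2d_pt_id1|now apply C2].
    - apply continuity_2d_pt_mult; [|now apply C2].
      apply (continuity_1d_2d_pt_comp (fun e => e ^ 2) (fun u _ => u)).
      + apply continuity_pt_filterlim, (ex_derive_continuous (fun e => e ^ 2)).
        auto_derive; auto.
      + apply continuity_2d_pt_id1. }
  assert (P0 : forall t, P 0 t = p t) by (intros t; unfold P; ring).
  assert (Ce : forall e t, continuous (P e) t).
  { intros e t; unfold P; apply (continuous_plus (fun t => p t + e * q t)).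
    - apply (continuous_plus p); [apply Cp|apply (continuous_scal_r e q), Cq].
    - apply (continuous_scal_r (e ^ 2) r), Cr. }
  assert (Dpow : forall e t, 0 < P e t ->
     is_derive (fun e => Rpower (P e t) a) e
       (a * Rpower (P e t) (a - 1) * (q t + 2 * e * r t))).
  { intros e t H; evar_last; [apply (is_derive_Rpower_comp a (fun e => P e t)); trivial|].
    - unfold P; auto_derive; auto.
    - simpl; ring. }
  destruct (continuity_ab_min p 0 T) as [m [Hm _]];
    [lra|intros; apply continuity_pt_filterlim, Cp|].
  destruct (uniform_continuity_2d_1d' P 0 T 0 (fun t _ => CP 0 t) (mkposreal _ (Pp m)))
    as [d Hd].
  assert (Ppos : forall e t, Rabs e < d -> 0 <= t <= T -> 0 < P e t).
  { intros e t He Ht; apply Rabs_def2 in He.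
    assert (A := Hd t 0 t e Ht ltac:(lra) Ht ltac:(lra)).
    rewrite Rminus_diag, Rabs_R0 in A.
    specialize (A ltac:(lra)); simpl in A; apply Rabs_def2 in A.
    rewrite P0 in A; specialize (Hm t Ht); lra. }
  evar_last.
  - apply (is_derive_RInt_param (fun e t => Rpower (P e t) a) 0 T 0).
    + exists d; intros e He t Ht.
      rewrite Rmin_left, Rmax_right in Ht by lra.
      change (Rabs (e - 0) < d) in He; rewrite Rminus_0_r in He.
      eexists; apply Dpow; auto.
    (* The closed form agrees with [Derive] only where [P] is positive; continuity of [P] at
       [(0, t)] with tolerance [p t] supplies such a neighbourhood. *)
    + intros t _.
      apply (continuity_2d_pt_ext_loc
        (fun e t => a * Rpower (P e t) (a - 1) * (q t + 2 * e * r t))).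
      * destruct (CP 0 t (mkposreal _ (Pp t))) as [d' Hd'].
        exists d'; intros u v Hu Hv; symmetry; apply is_derive_unique, Dpow.
        specialize (Hd' u v Hu Hv); simpl in Hd'; apply Rabs_def2 in Hd'.
        rewrite P0 in Hd'; lra.
      * apply continuity_2d_pt_mult; [apply continuity_2d_pt_mult|].
        -- apply continuity_2d_pt_const.
        -- apply (continuity_1d_2d_pt_comp (fun y => Rpower y (a - 1)) P); trivial.
           apply continuity_pt_filterlim, (ex_derive_continuous (fun y => Rpower y (a - 1))).
           eexists; apply is_derive_Rpower; rewrite P0; auto.
        -- apply continuity_2d_pt_plus; [now apply C2|].
           apply continuity_2d_pt_mult; [|now apply C2].
           apply continuity_2d_pt_mult; [apply continuity_2d_pt_const|apply continuity_2d_pt_id1].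
    + exists d; intros e He; change (Rabs (e - 0) < d) in He; rewrite Rminus_0_r in He.
      apply (ex_RInt_continuous (fun t => Rpower (P e t) a)); intros t Ht.
      rewrite Rmin_left, Rmax_right in Ht by lra.
      apply (continuous_comp (P e) (fun y => Rpower y a)); trivial.
      apply (ex_derive_continuous (fun y => Rpower y a)); eexists; apply is_derive_Rpower; auto.
  - apply RInt_ext; intros t _; apply is_derive_unique.
    evar_last; [apply Dpow; rewrite P0; auto|].
    rewrite P0; ring.
Qed.

(** * Deformations and the first variation of the curvature *)

Lemma smooth_curve_velocity g : smooth_curve g -> smooth_curve (velocity g).
Proof. intros [X Y]; split; now apply smooth_Derive. Qed.

Lemma smooth_det g v :
  smooth_curve g -> smooth_curve v -> smooth (fun t => det (g t) (v t)).
Proof. intros [X Y] [X' Y']; unfold det; auto with smooth. Qed.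

Lemma smooth_curvature g : smooth_curve g -> smooth (curvature g).
Proof. intros G; apply smooth_det; auto using smooth_curve_velocity. Qed.

Lemma smooth_deformation_field g f :
  smooth_curve g -> smooth f -> smooth_curve (deformation_field g f).
Proof.
  intros [X Y] F.
  assert (F' : smooth (fun t => - (Derive f t / 2))).
  { apply smooth_opp; apply smooth_mult; auto with smooth. }
  split; apply smooth_plus; apply smooth_mult; trivial; now apply smooth_Derive.
Qed.

Lemma velocity_deform g v e :
  smooth_curve g -> smooth_curve v ->
  velocity (deform g v e) = deform (velocity g) (velocity v) e.
Proof.
  intros [X Y] [X' Y']; apply functional_extensionality; intros t.
  apply injective_projections; simpl; apply is_derive_unique;
    apply @is_derive_plus; try apply is_derive_scal; now apply smooth_is_derive.
Qed.

(** By bilinearity of [det] the expansion in [e] is exact and quadratic, which is the shape that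
    [first_variation_RInt_Rpower] differentiates. *)
Lemma curvature_deform g v e t :
  smooth_curve g -> smooth_curve v ->
  curvature (deform g v e) t =
  curvature g t
  + e * (det (velocity g t) (velocity (velocity v) t)
         + det (velocity v t) (velocity (velocity g) t))
  + e ^ 2 * curvature v t.
Proof.
  intros G V; unfold curvature.
  rewrite !velocity_deform; auto using smooth_curve_velocity.
  unfold det, deform, plus, scal; simpl; unfold plus, scal; simpl; unfold mult; simpl; ring.
Qed.

(** The derivative at 0 is zero by criticality and equals this integral by differentiation under the
    integral sign; derivatives are unique. *)
Lemma critical_curve_RInt a T g f :
  0 < T -> centroaffine_curve T g -> critical_curve a T g -> smooth f -> periodic T f ->
  let v := deformation_field g f in
  RInt (fun t => a * Rpower (curvature g t) (a - 1) *
          (det (velocity g t) (velocity (velocity v) t)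
           + det (velocity v t) (velocity (velocity g) t))) 0 T = 0.
Proof.
  intros HT [G _ _ P] C F PF v.
  assert (V : smooth_curve v) by now apply smooth_deformation_field.
  assert (G' := smooth_curve_velocity _ G); assert (V' := smooth_curve_velocity _ V).
  specialize (C f F PF).
  apply is_derive_unique in C; refine (eq_trans (eq_sym _) C); apply is_derive_unique.
  apply (is_derive_ext (fun e => RInt (fun t => Rpower (curvature g t + e *
     (det (velocity g t) (velocity (velocity v) t)
         + det (velocity v t) (velocity (velocity g) t)) + e ^ 2 * curvature v t) a) 0 T)).
  - intros e; apply RInt_ext; intros t _; now rewrite curvature_deform.
  - apply first_variation_RInt_Rpower; trivial; intros t; apply smooth_continuous.
    + now apply smooth_curvature.
    + apply smooth_plus; apply smooth_det; auto using smooth_curve_velocity.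
    + now apply smooth_curvature.
Qed.

Lemma is_derive_wronskian x y t :
  smooth x -> smooth y ->
  is_derive (fun t => x t * Derive y t - y t * Derive x t) t
    (x t * Derive (Derive y) t - y t * Derive (Derive x) t).
Proof.
  intros X Y; auto_derive.
  - repeat split; apply smooth_ex_derive; auto with smooth.
  - eta_Derive.
    ring.
Qed.

(** Differentiating [[gamma, gamma'] = 1] gives [[gamma, gamma''] = 0], so [gamma''] is a multiple
    of [gamma]; pairing with [gamma'] identifies the factor. *)
Lemma centroaffine_frenet T g t :
  centroaffine_curve T g ->
  velocity (velocity g) t = scal (- curvature g t) (g t).
Proof.
  intros [[X Y] _ U _].
  assert (E : det (g t) (velocity (velocity g) t) = 0).
  { assert (D : is_derive (fun t => det (g t) (velocity g t)) t
                  (det (g t) (velocity (velocity g) t))).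
    { exact (is_derive_wronskian _ _ t X Y). }
    apply is_derive_unique in D; rewrite <- D.
    rewrite (Derive_ext _ (fun _ => 1)) by apply U; apply Derive_const. }
  specialize (U t); unfold curvature.
  revert U E; generalize (velocity (velocity g) t) (velocity g t) (g t).
  intros [x2 y2] [x1 y1] [x0 y0]; unfold det; simpl; intros U E.
  apply injective_projections; simpl; unfold scal; simpl; unfold mult; simpl.
  (* Inserting the factor [[gamma, gamma'] = 1] turns the claim into a polynomial identity modulo
     [[gamma, gamma''] = 0]. *)
  - replace x2 with (x2 * (x0 * y1 - y0 * x1)) at 1 by (rewrite U; ring).
    assert (x1 * (x0 * y2 - y0 * x2) = 0) by (rewrite E; ring); lra.
  - replace y2 with (y2 * (x0 * y1 - y0 * x1)) at 1 by (rewrite U; ring).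
    assert (y1 * (x0 * y2 - y0 * x2) = 0) by (rewrite E; ring); lra.
Qed.

(** One coordinate of [v_f], with [x'' = - p x] used to express each derivative in [x] and [x']. The
    choice of [- f' / 2] is what keeps [f''] out of the coefficient of [x']. *)
Lemma deformation_derivatives (x f p : R -> R) :
  smooth x -> smooth f -> smooth p ->
  (forall t, Derive (Derive x) t = - p t * x t) ->
  let X := fun t => - (Derive f t / 2) * x t + f t * Derive x t in
  (forall t, Derive X t =
     (- (Derive (Derive f) t / 2) - p t * f t) * x t + Derive f t / 2 * Derive x t) /\
  (forall t, Derive (Derive X) t =
     (- (Derive (Derive (Derive f)) t / 2) - Derive p t * f t - 3 / 2 * p t * Derive f t) * x t
     - p t * f t * Derive x t).
Proof.
  intros Sx Sf Sp E X.
  assert (D : forall g t, smooth g -> ex_derive (fun s => g s) t)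
    by (intros; now apply smooth_ex_derive).
  assert (X1 : forall t, Derive X t =
     (- (Derive (Derive f) t / 2) - p t * f t) * x t + Derive f t / 2 * Derive x t).
  { intros t; apply is_derive_unique; unfold X; auto_derive.
    - repeat split; apply D; auto with smooth.
    - eta_Derive.
      rewrite E; field. }
  split; trivial.
  intros t; rewrite (Derive_ext _ _ t X1); apply is_derive_unique; auto_derive.
  - repeat split; apply D; auto with smooth.
  - eta_Derive.
    rewrite E; field.
Qed.

Lemma curvature_first_variation T g f t :
  centroaffine_curve T g -> smooth f ->
  let p := curvature g in
  let v := deformation_field g f in
  det (velocity g t) (velocity (velocity v) t) + det (velocity v t) (velocity (velocity g) t)
  = Derive (Derive (Derive f)) t / 2 + 2 * p t * Derive f t + Derive p t * f t.
Proof.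
  intros C F p v.
  assert (Sp : smooth p) by apply smooth_curvature, C.
  assert (U := ca_param _ _ C t).
  assert (E2 : forall t, velocity (velocity g) t = scal (- p t) (g t))
    by (intros; apply (centroaffine_frenet T g _ C)).
  destruct (ca_smooth _ _ C) as [X Y].
  destruct (deformation_derivatives _ f p X F Sp (fun t => f_equal fst (E2 t))) as [X1 X2].
  destruct (deformation_derivatives _ f p Y F Sp (fun t => f_equal snd (E2 t))) as [Y1 Y2].
  replace (velocity (velocity v) t) with
    (Derive (Derive (fun t => - (Derive f t / 2) * fst (g t) + f t * Derive (fun s => fst (g s)) t)) t,
     Derive (Derive (fun t => - (Derive f t / 2) * snd (g t) + f t * Derive (fun s => snd (g s)) t)) t)
    by reflexivity.
  replace (velocity v t) with
    (Derive (fun t => - (Derive f t / 2) * fst (g t) + f t * Derive (fun s => fst (g s)) t) t,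
     Derive (fun t => - (Derive f t / 2) * snd (g t) + f t * Derive (fun s => snd (g s)) t) t)
    by reflexivity.
  rewrite X1, X2, Y1, Y2, E2.
  unfold det in *; unfold velocity in *; simpl in *.
  unfold scal; simpl; unfold mult; simpl.
  (* In the frame [(gamma, gamma')] both determinants are multiples of [[gamma, gamma']], which is
     1. *)
  transitivity ((Derive (Derive (Derive f)) t / 2 + 2 * p t * Derive f t + Derive p t * f t)
     * (fst (g t) * Derive (fun s => snd (g s)) t - snd (g t) * Derive (fun s => fst (g s)) t)).
  - field.
  - rewrite U; ring.
Qed.

(** * The Euler-Lagrange equation for the exponent 1/3 *)

Lemma periodic_velocity T g : smooth_curve g -> periodic T g -> periodic T (velocity g).
Proof.
  intros [X Y] P t; apply injective_projections; simpl; apply periodic_Derive;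
    try (intros s; now apply smooth_ex_derive); intros s; now rewrite P.
Qed.

Lemma periodic_curvature T g : smooth_curve g -> periodic T g -> periodic T (curvature g).
Proof.
  intros G P t; unfold curvature.
  assert (P1 := periodic_velocity T g G P).
  now rewrite P1, (periodic_velocity T _ (smooth_curve_velocity _ G) P1).
Qed.

(** These polynomial relations between [p], [h] and [G] replace fractional powers in all later
    computations. *)
Lemma cube_root_relations p :
  0 < p ->
  Rpower p (1 / 3) ^ 3 = p /\ Rpower p (1 / 3 - 1) * Rpower p (1 / 3) ^ 2 = 1.
Proof.
  intros P.
  assert (H : 0 < Rpower p (1 / 3)) by apply exp_pos.
  rewrite <- !Rpower_pow, !Rpower_mult, <- Rpower_plus by trivial; split.
  - replace (1 / 3 * INR 3) with 1 by (simpl; field); now apply Rpower_1.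
  - replace (1 / 3 - 1 + 1 / 3 * INR 2) with 0 by (simpl; field); now apply Rpower_O.
Qed.

Lemma cube_root_derivatives (p h G : R -> R) t :
  smooth h -> smooth G ->
  (forall t, h t ^ 3 = p t) -> (forall t, G t * h t ^ 2 = 1) ->
  Derive p t = 3 * h t ^ 2 * Derive h t /\
  Derive G t * h t ^ 2 + 2 * G t * h t * Derive h t = 0.
Proof.
  intros Sh SG H3 H2; split.
  - rewrite <- (Derive_ext _ _ t H3); apply is_derive_unique; auto_derive.
    + now apply smooth_ex_derive.
    + eta_Derive; ring.
  - transitivity (Derive (fun t => G t * h t ^ 2) t).
    + symmetry; apply is_derive_unique; auto_derive.
      * split; [|split]; trivial; now apply smooth_ex_derive.
      * eta_Derive; ring.
    + rewrite (Derive_ext _ _ t H2); apply Derive_const.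
Qed.

(* The first variation is minus the pairing of [f] with the Euler-Lagrange expression
   [k'], up to a boundary term [B]; testing it on [f = k'] itself forces [k' = 0]. *)
Lemma critical_affine_curvature_constant T g :
  0 < T -> centroaffine_curve T g -> critical_curve (1 / 3) T g ->
  let h := fun t => Rpower (curvature g t) (1 / 3) in
  let G := fun t => Rpower (curvature g t) (1 / 3 - 1) in
  forall t, Derive (fun t => Derive (Derive G) t / 2 - h t) t = 0.
Proof.
  intros HT C Cr h G.
  set (p := curvature g) in *.
  assert (Sg := ca_smooth _ _ C).
  assert (Pp : forall t, 0 < p t) by apply (ca_curvature_pos _ _ C).
  assert (Sp : smooth p) by now apply smooth_curvature.
  assert (Sh : smooth h) by now apply smooth_Rpower.
  assert (SG : smooth G) by now apply smooth_Rpower.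
  assert (Perp : periodic T p) by (apply periodic_curvature; trivial; apply C).
  assert (Perh : periodic T h) by (intros t; unfold h; now rewrite Perp).
  assert (PerG : periodic T G) by (intros t; unfold G; now rewrite Perp).
  assert (PD : forall f, smooth f -> periodic T f -> periodic T (Derive f)).
  { intros f F P; apply periodic_Derive; trivial; intros; now apply smooth_ex_derive. }
  set (k := fun t => Derive (Derive G) t / 2 - h t).
  assert (Sk : smooth k).
  { apply smooth_minus; trivial; apply smooth_mult; auto with smooth. }
  assert (Perk : periodic T k).
  { intros t; unfold k; rewrite Perh, (PD (Derive G)); auto with smooth. }
  set (f := Derive k).
  assert (Sf : smooth f) by now apply smooth_Derive.
  assert (Perf : periodic T f) by now apply PD.
  assert (Perf1 : periodic T (Derive f)) by now apply PD.
  assert (Perf2 : periodic T (Derive (Derive f))) by (apply PD; auto with smooth).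
  assert (Perf3 : periodic T (Derive (Derive (Derive f)))) by (apply PD; auto with smooth).
  assert (PerG1 : periodic T (Derive G)) by now apply PD.
  assert (PerG2 : periodic T (Derive (Derive G))) by (apply PD; auto with smooth).
  assert (Perp1 : periodic T (Derive p)) by now apply PD.
  (* The operator [f'''/2 + 2 p f' + p' f] is skew-adjoint, so its adjoint applied to [G] is, up to
     sign, the same expression in [G]. Its lower-order terms are [- 4 h' + 3 h' = - h'], hence the
     value [k']. *)
  assert (EL : forall t, f t = Derive (Derive (Derive G)) t / 2
                 + 2 * p t * Derive G t + Derive p t * G t).
  { intros t.
    assert (H3 : forall t, h t ^ 3 = p t) by (intros; now apply cube_root_relations).
    assert (H2 : forall t, G t * h t ^ 2 = 1) by (intros; now apply cube_root_relations).
    destruct (cube_root_derivatives p h G t Sh SG H3 H2) as [E1 E2].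
    replace (f t) with (Derive (Derive (Derive G)) t / 2 - Derive h t).
    - rewrite E1, <- H3; specialize (H2 t).
      replace (2 * h t ^ 3 * Derive G t) with (2 * h t * (Derive G t * h t ^ 2)) by ring.
      replace (Derive G t * h t ^ 2) with (- (2 * G t * h t * Derive h t)) by lra.
      replace (2 * h t * - (2 * G t * h t * Derive h t))
        with (- 4 * (G t * h t ^ 2) * Derive h t) by ring.
      replace (3 * h t ^ 2 * Derive h t * G t) with (3 * (G t * h t ^ 2) * Derive h t) by ring.
      rewrite H2; field.
    - symmetry; apply is_derive_unique; unfold k; auto_derive.
      + repeat split; apply smooth_ex_derive; auto with smooth.
      + eta_Derive.
        field. }
  set (Q := fun t => Derive (Derive (Derive f)) t / 2 + 2 * p t * Derive f t + Derive p t * f t).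
  assert (SQ : smooth (fun t => 1 / 3 * G t * Q t)).
  { assert (smooth (fun t => Derive (Derive (Derive f)) t / 2)).
    { apply smooth_mult; auto with smooth. }
    unfold Q; auto 10 with smooth. }
  assert (PerQ : periodic T (fun t => 1 / 3 * G t * Q t)).
  { intros t; unfold Q; now rewrite PerG, Perf3, Perp, Perf1, Perp1, Perf. }
  assert (Int : RInt (fun t => 1 / 3 * G t * Q t) 0 T = 0).
  { refine (eq_trans _ (critical_curve_RInt _ T g f HT C Cr Sf Perf)); apply RInt_ext.
    intros t _; now rewrite (curvature_first_variation T g f t C Sf). }
  (* Integration by parts in differential form: [B' = G Q + f * f], where the last term is [f] times
     the right-hand side of [EL]. *)
  set (B := fun t => (G t * Derive (Derive f) t - Derive G t * Derive f t
                        + Derive (Derive G) t * f t) / 2 + 2 * p t * G t * f t).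
  (* The factor 3 cancels the exponent 1/3, so [H' = f * f]; [H] is periodic because the integral
     over a period vanishes by criticality. *)
  set (H := fun t => B t - 3 * RInt (fun t => 1 / 3 * G t * Q t) 0 t).
  assert (PerH : periodic T H).
  { intros t; unfold H, B.
    rewrite primitive_shift, Int; trivial; [|intros; now apply smooth_continuous].
    rewrite PerG, Perf2, PerG1, Perf1, PerG2, Perf, Perp; ring. }
  assert (DH : forall t, is_derive H t (f t * f t)).
  { intros t; unfold H.
    evar_last.
    - apply @is_derive_minus.
      + unfold B; auto_derive; [|reflexivity].
        repeat split; apply smooth_ex_derive; auto with smooth.
      + apply is_derive_scal, is_derive_primitive; intros; now apply smooth_continuous.
    - unfold minus, plus, opp; simpl.
      eta_Derive.
      transitivity (f t * (Derive (Derive (Derive G)) t / 2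
                           + 2 * p t * Derive G t + Derive p t * G t)).
      + unfold Q; field.
      + now rewrite <- EL. }
  intros t; change (f t = 0).
  apply Rsqr_0_uniq; unfold Rsqr.
  apply (periodic_monotone_derive_zero T H (fun t => f t * f t)); trivial.
  intros s; nra.
Qed.

(* [G * h * Derive x] is the first derivative of [x] with respect to affine arclength
   [ds = h dt], and [Derive G / 2 * Derive x - h * x] the second one. *)
Lemma affine_arclength_system (x h G : R -> R) k t :
  smooth x -> smooth h -> smooth G ->
  (forall t, 0 < h t) -> (forall t, G t * h t ^ 2 = 1) ->
  (forall t, Derive (Derive x) t = - h t ^ 3 * x t) ->
  (forall t, Derive (Derive G) t / 2 - h t = k) ->
  let V := fun t => G t * h t * Derive x t in
  let W := fun t => Derive G t / 2 * Derive x t - h t * x t in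
  is_derive x t (h t * V t) /\ is_derive V t (h t * W t) /\ is_derive W t (k * h t * V t).
Proof.
  intros Sx Sh SG Ph H2 Ex Ek V W.
  destruct (cube_root_derivatives (fun t => h t ^ 3) h G t Sh SG (fun _ => eq_refl) H2)
    as [_ E2].
  specialize (Ph t); specialize (H2 t); specialize (Ex t); specialize (Ek t).
  (* One positive factor [h t] is cancelled from the differentiated relation [G h^2 = 1]. *)
  assert (E2' : Derive G t * h t = - (2 * G t * Derive h t)).
  { apply (Rmult_eq_reg_r (h t)); lra. }
  split; [|split].
  - replace (h t * V t) with (G t * h t ^ 2 * Derive x t) by (unfold V; ring).
    rewrite H2, Rmult_1_l; now apply smooth_is_derive.
  - unfold V, W; auto_derive.
    + repeat split; apply smooth_ex_derive; auto with smooth.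
    + eta_Derive; rewrite Ex.
      transitivity ((Derive G t * h t + G t * Derive h t) * Derive x t
                    - G t * h t ^ 2 * h t ^ 2 * x t); [ring|].
      transitivity (Derive G t * h t / 2 * Derive x t - h t ^ 2 * x t); [|field].
      rewrite E2', H2; field.
  - unfold V, W; auto_derive.
    + repeat split; apply smooth_ex_derive; auto with smooth.
    (* The terms in [x] cancel through [E2'], and the coefficient of [x'] that remains is
       [G''/2 - h = k]. *)
    + eta_Derive; rewrite Ex.
      replace (k * h t * (G t * h t * Derive x t)) with (k * (G t * h t ^ 2) * Derive x t)
        by ring.
      replace (Derive G t * / 2 * (1 * (- h t ^ 3 * x t)))
        with (- (Derive G t * h t) / 2 * h t ^ 2 * x t) by field.
      rewrite E2'.
      replace (- - (2 * G t * Derive h t) / 2 * h t ^ 2 * x t)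
        with (G t * h t ^ 2 * Derive h t * x t) by field.
      rewrite H2, <- Ek; field.
Qed.

(** * Uniform circular motion and closing up *)

(** The pair [(V, W / w)] rotates with angle [theta], which yields the first integrals [CA] and
    [CB]; [CC] says that the centre [x + W / w^2] is fixed. Inverting the rotation gives the
    formulas without a uniqueness theorem for differential equations. *)
Lemma harmonic_solution (x V W h theta : R -> R) w :
  w <> 0 ->
  (forall t, is_derive x t (h t * V t)) ->
  (forall t, is_derive V t (h t * W t)) ->
  (forall t, is_derive W t (- w ^ 2 * h t * V t)) ->
  (forall t, is_derive theta t (w * h t)) -> theta 0 = 0 ->
  (forall t, V t = cos (theta t) * V 0 + sin (theta t) * (W 0 / w)) /\
  (forall t, x t = (x 0 + W 0 / w ^ 2) + (cos (theta t) * (- W 0 / w ^ 2)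
                                          + sin (theta t) * (V 0 / w))).
Proof.
  intros Hw Dx DV DW Dth H0.
  assert (CA : forall t, cos (theta t) * V t - sin (theta t) / w * W t = V 0).
  { intros t; rewrite (constant_of_derive_zero
      (fun t => cos (theta t) * V t - sin (theta t) / w * W t)) with (t := 0).
    - rewrite H0, cos_0, sin_0; field; trivial.
    - intros s; auto_derive.
      + repeat split; eexists; eauto.
      + eta_Derive; rewrite (is_derive_unique _ _ _ (Dth s)), (is_derive_unique _ _ _ (DV s)),
          (is_derive_unique _ _ _ (DW s)); field; trivial. }
  assert (CB : forall t, w * sin (theta t) * V t + cos (theta t) * W t = W 0).
  { intros t; rewrite (constant_of_derive_zero
      (fun t => w * sin (theta t) * V t + cos (theta t) * W t)) with (t := 0).
    - rewrite H0, cos_0, sin_0; field; trivial.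
    - intros s; auto_derive.
      + repeat split; eexists; eauto.
      + eta_Derive; rewrite (is_derive_unique _ _ _ (Dth s)), (is_derive_unique _ _ _ (DV s)),
          (is_derive_unique _ _ _ (DW s)); field; trivial. }
  assert (CC : forall t, x t + W t / w ^ 2 = x 0 + W 0 / w ^ 2).
  { intros t; apply (constant_of_derive_zero (fun t => x t + W t / w ^ 2)); intros s.
    auto_derive.
    - repeat split; eexists; eauto.
    - eta_Derive; rewrite (is_derive_unique _ _ _ (Dx s)), (is_derive_unique _ _ _ (DW s));
        field; trivial. }
  assert (SC : forall t, cos (theta t) ^ 2 = 1 - sin (theta t) ^ 2).
  { intros t; generalize (sin2_cos2 (theta t)); unfold Rsqr; intros; lra. }
  split; intros t.
  - rewrite <- (CA t), <- (CB t).
    transitivity ((cos (theta t) ^ 2 + sin (theta t) ^ 2) * V t);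
      [rewrite SC; ring|field; trivial].
  - rewrite <- (CC t), <- (CA t), <- (CB t).
    transitivity (x t + W t / w ^ 2 - (cos (theta t) ^ 2 + sin (theta t) ^ 2) * W t / w ^ 2);
      [rewrite SC; field; trivial|field; trivial].
Qed.

(** From [cos L = 1 - 2 sin^2 (L / 2)], half of [L] is an integer multiple of [PI], and positivity
    of [L] makes that integer positive. *)
Lemma full_turns L : 0 < L -> cos L = 1 -> exists m : nat, (1 <= m)%nat /\ L = 2 * PI * INR m.
Proof.
  intros HL HC.
  assert (S : sin (L / 2) = 0).
  { apply Rsqr_0_uniq; unfold Rsqr.
    replace L with (2 * (L / 2)) in HC by field; rewrite cos_2a_sin in HC; lra. }
  destruct (sin_eq_0_0 _ S) as [z Hz].
  assert (HP := PI_RGT_0).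
  assert (Hz0 : (0 < z)%Z).
  { apply lt_IZR; apply (Rmult_lt_reg_r PI); lra. }
  exists (Z.to_nat z); split; [lia|].
  rewrite INR_IZR_INZ, Z2Nat.id by lia; lra.
Qed.

Theorem theorem3 (T : R) (gamma : R -> plane) :
  0 < T ->
  centroaffine_curve T gamma ->
  critical_curve (1 / 3) T gamma ->
  multiply_traversed_ellipse T gamma.
Proof.
  intros HT C Cr.
  assert (EL := critical_affine_curvature_constant T gamma HT C Cr).
  set (h := fun t => Rpower (curvature gamma t) (1 / 3)) in *.
  set (G := fun t => Rpower (curvature gamma t) (1 / 3 - 1)) in *.
  assert (Sg := ca_smooth _ _ C).
  assert (Pg := ca_periodic _ _ C).
  assert (Pp := ca_curvature_pos _ _ C).
  assert (Sp := smooth_curvature _ Sg).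
  assert (Perp := periodic_curvature T _ Sg Pg).
  assert (Sh : smooth h) by now apply smooth_Rpower.
  assert (SG : smooth G) by now apply smooth_Rpower.
  assert (Perh : periodic T h) by (intros t; unfold h; now rewrite Perp).
  assert (PerG : periodic T G) by (intros t; unfold G; now rewrite Perp).
  assert (PerG1 : periodic T (Derive G)).
  { apply periodic_Derive; trivial; intros; now apply smooth_ex_derive. }
  assert (Ph : forall t, 0 < h t) by (intros; apply exp_pos).
  assert (H3 : forall t, h t ^ 3 = curvature gamma t)
    by (intros; now apply cube_root_relations).
  assert (H2 : forall t, G t * h t ^ 2 = 1) by (intros; now apply cube_root_relations).
  assert (Ek : exists k, forall t, Derive (Derive G) t / 2 - h t = k).
  { exists (Derive (Derive G) 0 / 2 - h 0); intros t.
    apply (constant_of_derive_zero (fun t => Derive (Derive G) t / 2 - h t)).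
    intros s; rewrite <- (EL s); apply smooth_is_derive.
    apply smooth_minus; trivial; apply smooth_mult; auto with smooth. }
  destruct Ek as [k Ek].
  assert (Hk : k < 0).
  { apply Rnot_le_lt; intros Hk.
    assert (A := increasing_of_derive_pos (Derive G) (Derive (Derive G))).
    specialize (A (fun t => smooth_is_derive _ t (smooth_Derive _ SG))).
    assert (B : forall t, 0 < Derive (Derive G) t).
    { intros t; specialize (Ek t); specialize (Ph t); lra. }
    specialize (A B 0 (0 + T)); rewrite PerG1 in A; lra. }
  set (w := sqrt (- k)).
  assert (Hw : 0 < w) by (apply sqrt_lt_R0; lra).
  assert (Hw2 : - w ^ 2 = k) by (unfold w; rewrite pow2_sqrt; lra).
  assert (Ch : forall t, continuous h t) by (intros; now apply smooth_continuous).
  (* Affine arclength from 0, scaled by the angular speed [w]. *)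
  set (theta := fun t => w * RInt h 0 t).
  assert (Dth : forall t, is_derive theta t (w * h t)).
  { intros t; apply is_derive_scal; now apply is_derive_primitive. }
  assert (Th0 : theta 0 = 0).
  { unfold theta; rewrite RInt_point; unfold zero; simpl; ring. }
  assert (ThT : forall t, theta (t + T) = theta t + theta T).
  { intros t; unfold theta; rewrite primitive_shift by trivial; ring. }
  assert (ThI : forall s t, s < t -> theta s < theta t).
  { apply (increasing_of_derive_pos theta (fun t => w * h t)); trivial.
    intros t; now apply Rmult_lt_0_compat. }
  assert (Fr : forall t, velocity (velocity gamma) t = scal (- h t ^ 3) (gamma t)).
  { intros t; rewrite H3; apply (centroaffine_frenet T gamma t C). }
  set (x := fun t => fst (gamma t)).
  set (y := fun t => snd (gamma t)).
  assert (Sx : smooth x) by apply Sg.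
  assert (Sy : smooth y) by apply Sg.
  assert (Px : forall t, Derive x (t + T) = Derive x t).
  { intros t; exact (f_equal fst (periodic_velocity T gamma Sg Pg t)). }
  assert (Py : forall t, Derive y (t + T) = Derive y t).
  { intros t; exact (f_equal snd (periodic_velocity T gamma Sg Pg t)). }
  assert (Ax := fun t => affine_arclength_system x h G k t Sx Sh SG Ph H2
                  (fun t => f_equal fst (Fr t)) Ek).
  assert (Ay := fun t => affine_arclength_system y h G k t Sy Sh SG Ph H2
                  (fun t => f_equal snd (Fr t)) Ek).
  set (V1 := fun t => G t * h t * Derive x t) in *.
  set (W1 := fun t => Derive G t / 2 * Derive x t - h t * x t) in *.
  set (V2 := fun t => G t * h t * Derive y t) in *.
  set (W2 := fun t => Derive G t / 2 * Derive y t - h t * y t) in *.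
  rewrite <- Hw2 in Ax, Ay.
  destruct (harmonic_solution x V1 W1 h theta w) as [SV1 Sol1];
    try apply Ax; trivial; [lra|].
  destruct (harmonic_solution y V2 W2 h theta w) as [SV2 Sol2];
    try apply Ay; trivial; [lra|].
  (* The affine arclength normalisation [[gamma_s, gamma_ss] = 1]; the terms in [G'] cancel. It
     serves both the closing condition and the nondegeneracy of the ellipse. *)
  assert (Dt : V1 0 * W2 0 - V2 0 * W1 0 = 1).
  { transitivity (G 0 * h 0 ^ 2 * det (gamma 0) (velocity gamma 0)).
    - unfold V1, V2, W1, W2, det, velocity; cbn [fst snd].
      fold x y; change (fst (gamma 0)) with (x 0); change (snd (gamma 0)) with (y 0); ring.
    - rewrite H2, (ca_param _ _ C); ring. }
  (* Since [gamma_s] takes the same value at [T] and 0, taking its determinant with [gamma_ss] at 0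
     removes the sine term and leaves [cos (theta T)]. *)
  assert (CL : cos (theta T) = 1).
  { assert (E1 : V1 T = V1 0).
    { unfold V1; rewrite <- (Rplus_0_l T) at 1 2 3; now rewrite PerG, Perh, Px. }
    assert (E2 : V2 T = V2 0).
    { unfold V2; rewrite <- (Rplus_0_l T) at 1 2 3; now rewrite PerG, Perh, Py. }
    rewrite SV1 in E1; rewrite SV2 in E2.
    transitivity (V1 0 * W2 0 - V2 0 * W1 0); [|trivial].
    rewrite <- E1 at 1; rewrite <- E2 at 1.
    transitivity (cos (theta T) * (V1 0 * W2 0 - V2 0 * W1 0)); [rewrite Dt; ring|].
    field; lra. }
  destruct (full_turns (theta T)) as [m [Hm HL]]; trivial.
  { rewrite <- Th0; now apply ThI. }
  (* Read off from [harmonic_solution]: centre [gamma + gamma_ss / w^2], semi-diameters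
     [- gamma_ss / w^2] and [gamma_s / w], all at 0. By [Dt] the determinant of the semi-diameters
     is [1 / w^3]. *)
  exists (x 0 + W1 0 / w ^ 2, y 0 + W2 0 / w ^ 2),
    (- W1 0 / w ^ 2, - W2 0 / w ^ 2), (V1 0 / w, V2 0 / w), theta, m.
  split; [|split; [|split; [|split; [|split]]]]; trivial.
  - unfold det; cbn [fst snd].
    replace (- W1 0 / w ^ 2 * (V2 0 / w) - - W2 0 / w ^ 2 * (V1 0 / w))
      with ((V1 0 * W2 0 - V2 0 * W1 0) / w ^ 3) by (field; lra).
    rewrite Dt; apply Rgt_not_eq, Rdiv_lt_0_compat; [lra|now apply pow_lt].
  - intros t; apply (ex_derive_continuous theta); eexists; apply Dth.
  - intros t; now rewrite ThT, HL.
  - intros t; apply injective_projections; [exact (Sol1 t)|exact (Sol2 t)].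
Qed.
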